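(* Let $\alpha = (\alpha_1,\dots,\alpha_n)$ be a graphic degree sequence with $\alpha_n \ge 1$. If $\mathcal{B}(\alpha) \neq \emptyset$ or $\mathcal{F}(\alpha) \neq \emptyset$, then every realization $G$ of $\alpha$ satisfies $\lambda(G) = \alpha_n$.
   Context: All graphs are simple and undirected. A degree sequence of length $n$ is an integer sequence $\alpha=(\alpha_1,\dots,\alpha_n)$ with $n-1 \ge \alpha_1 \ge \cdots \ge \alpha_n \ge 0$. A (labeled) realization of $\alpha$ is a simple graph on the labeled vertex set $\{v_1,\dots,v_n\}$ in which $v_i$ has degree $\alpha_i$ for every $i$; $\alpha$ is graphic if it has at least one realization. The forced set $\mathcal{F}(\alpha)$ is the set of all edges $v_iv_j$ (between labeled vertices, $i \ne j$) that appear in every realization of $\alpha$; the forbidden set $\mathcal{B}(\alpha)$ is the set of all edges $v_iv_j$ ($i \ne j$) that appear in no realization of $\alpha$. The edge connectivity $\lambda(G)$ is the minimum cardinality of an edge-cut of $G$, over all edge-cuts (sets of edges whose removal disconnects $G$). *)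

(* Defs.v *)
From mathcomp Require Import all_boot.

Set Implicit Arguments.
Unset Strict Implicit.
Unset Printing Implicit Defensive.

Section Graphs.

Variable T : finType.

(* A simple graph with vertex set T is given by its edge set, an edge being
   the two-element set of its end vertices. *)
Definition simple_graph (G : {set {set T}}) : bool :=
  [forall e in G, #|e| == 2].

Definition adj (G : {set {set T}}) : rel T := [rel x y | [set x; y] \in G].

Definition degree (G : {set {set T}}) (x : T) : nat := #|[set y | adj G x y]|.

Definition connected_graph (G : {set {set T}}) : bool :=
  [forall x, forall y, connect (adj G) x y].

Definition edge_cut (G D : {set {set T}}) : bool :=
  (D \subset G) && ~~ connected_graph (G :\: D).

(* The default G of the minimum is an edge cut as soon as there are two
   vertices (edge_cut_all); with fewer vertices there is no edge cut and the
   value is #|G|, which is 0 for a simple graph. *)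
Definition edge_connectivity (G : {set {set T}}) : nat :=
  #|[arg min_(D < G | edge_cut G D) #|D|]|.

Lemma edge_cut_all (G : {set {set T}}) : 1 < #|T| -> edge_cut G G.
Proof.
case/card_gt1P=> x [y [_ _ xy]]; rewrite /edge_cut subxx setDv /=.
apply: contra xy => /forallP/(_ x)/forallP/(_ y)/connectP[[|z p]] /=.
  by move=> _ ->.
by rewrite /adj /= inE.
Qed.

Lemma edge_connectivityP (G : {set {set T}}) : 1 < #|T| ->
  (exists2 D, edge_cut G D & #|D| = edge_connectivity G) /\
  (forall D, edge_cut G D -> edge_connectivity G <= #|D|).
Proof.
move=> T_gt1; rewrite /edge_connectivity.
by case: arg_minnP => [|D cutD minD]; [exact: edge_cut_all | split; first exists D].
Qed.

End Graphs.

Section DegreeSequences.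

Variable n : nat.

Definition degree_sequence (alpha : n.-tuple nat) : bool :=
  sorted geq alpha && all (fun d => d <= n.-1) alpha.

Definition realization (alpha : n.-tuple nat) (G : {set {set 'I_n}}) : bool :=
  simple_graph G && [forall i, degree G i == tnth alpha i].

Definition graphic (alpha : n.-tuple nat) : bool :=
  [exists G, realization alpha G].

Definition forced (alpha : n.-tuple nat) : {set {set 'I_n}} :=
  [set e : {set 'I_n} | (#|e| == 2) &&
    [forall G, realization alpha G ==> (e \in G)]].

Definition forbidden (alpha : n.-tuple nat) : {set {set 'I_n}} :=
  [set e : {set 'I_n} | (#|e| == 2) &&
    [forall G, realization alpha G ==> (e \notin G)]].

End DegreeSequences.

(* Main.v *)
Require Import Defs.
From mathcomp Require Import all_boot.

Set Implicit Arguments.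
Unset Strict Implicit.
Unset Printing Implicit Defensive.

(** Let [delta] be the last term of [alpha]; isolating a vertex of minimum
degree gives [lambda <= delta].  If a realization had fewer than [delta] edges
between [S] and its complement, then for [u] in [S] and [y] outside [S] some
neighbour of [u] in [S] would not be adjacent to [y].  Repeated use of this fact
yields, through any pair [uv], an alternating closed trail of length 4 or 6, so
that at most two switches make [uv] change status without altering degrees: no
edge is forced and none is forbidden. *)

Section Switching.

Variable T : finType.
Implicit Types (G H : {set {set T}}) (S : {set T}).

(** * Edges and degrees of simple graphs *)

Lemma eq_set2 (a b c d : T) :
  ([set a; b] == [set c; d]) = (a == c) && (b == d) || (a == d) && (b == c).
Proof.
apply/eqP/orP => [E|[]/andP[/eqP-> /eqP->] //]; last by rewrite setUC.
have: a \in [set c; d] by rewrite -E set21.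
have: b \in [set c; d] by rewrite -E set22.
have: c \in [set a; b] by rewrite E set21.
have: d \in [set a; b] by rewrite E set22.
rewrite !inE ![d == _]eq_sym ![c == _]eq_sym.
by case: (a == c); case: (a == d); case: (b == c); case: (b == d); auto.
Qed.

Lemma adjC G (x y : T) : adj G x y = adj G y x.
Proof. by rewrite /adj /= setUC. Qed.

Lemma adj_neq G (x y : T) : simple_graph G -> adj G x y -> x != y.
Proof.
by move=> /forallP/(_ [set x; y])/implyP sG /sG; rewrite cards2; case: (x != y).
Qed.

Lemma simple_graph_edge G (e : {set T}) : simple_graph G -> e \in G ->
  exists x y, x != y /\ e = [set x; y].
Proof. by move=> /forallP/(_ e)/implyP sG /sG/cards2P. Qed.

(** In this form the effect of inserting or deleting a single edge on a degree can be read off as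
    one summand. *)
Lemma degreeE G (x : T) : simple_graph G -> degree G x = \sum_(e in G) (x \in e).
Proof.
move=> sG; rewrite -big_mkcondr sum1_card /degree /=.
have inj : {in [set y | adj G x y] &, injective (fun y => [set x; y])}.
  move=> y z; rewrite !inE => xy xz /eqP; rewrite eq_set2 eqxx /=.
  by rewrite [x == z](negPf (adj_neq sG xz)) orbF => /eqP.
rewrite -(card_in_imset inj); apply: eq_card => e; rewrite [RHS]inE.
apply/imsetP/andP => [[y] | [eG xe]]; first by rewrite inE => xy ->; rewrite set21.
have [a [b [ab E]]] := simple_graph_edge sG eG.
move: xe eG; rewrite {}E !inE => /orP[]/eqP-> abG; first by exists b; rewrite ?inE.
by exists a; [rewrite inE adjC | rewrite setUC].
Qed.

(** When [G] realizes a sequence, these [H] are exactly its realizations; the switching argument can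
    thus ignore the ordering of the sequence. *)
Definition same_degrees G H := simple_graph H /\ degree H =1 degree G.

Lemma same_degrees_trans G H K :
  same_degrees G H -> same_degrees H K -> same_degrees G K.
Proof. by move=> [_ GH] [sK HK]; split=> // x; rewrite HK. Qed.

Lemma set2_neq (p q r s : T) : p != r -> p != s -> [set p; q] != [set r; s].
Proof. by rewrite eq_set2 => /negPf-> /negPf->. Qed.

(** * Switches along alternating 4-cycles *)

Section Switch.

Variables (G : {set {set T}}) (a b c d : T).
Hypotheses (sG : simple_graph G) (ab : adj G a b) (cd : adj G c d)
  (nac : ~~ adj G a c) (nbd : ~~ adj G b d) (neq_ac : a != c) (neq_bd : b != d).

(** The exchange of edges and non-edges along the alternating cycle a-b-d-c-a. Only [a != c] and
    [b != d] need assuming: the other pairs are distinct because edges and non-edges differ. *)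
Definition switch : {set {set T}} :=
  [set a; c] |: ([set b; d] |: (G :\ [set a; b] :\ [set c; d])).

Lemma adj_switch (x y : T) :
  adj switch x y =
  [|| [set x; y] == [set a; c], [set x; y] == [set b; d] |
    [&& [set x; y] != [set c; d], [set x; y] != [set a; b] & adj G x y]].
Proof. by rewrite /adj /= !inE. Qed.

Lemma switch_added : adj switch a c.
Proof. by rewrite adj_switch eqxx. Qed.

Lemma switch_removed : ~~ adj switch a b.
Proof.
rewrite adj_switch eqxx andbF orbF negb_or.
by apply/andP; split; [apply: contraNneq nac | apply: contraNneq nbd] => E;
  rewrite /adj /= -E.
Qed.

Lemma switch_kept_edge (x y : T) : adj G x y -> [set x; y] != [set a; b] ->
  [set x; y] != [set c; d] -> adj switch x y.
Proof. by move=> xy ?? ; rewrite adj_switch; apply/or3P/Or33/and3P. Qed.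

Lemma switch_kept_nonedge (x y : T) : ~~ adj G x y -> [set x; y] != [set a; c] ->
  [set x; y] != [set b; d] -> ~~ adj switch x y.
Proof. by rewrite adj_switch => /negPf-> /negPf-> /negPf->; rewrite !andbF. Qed.

Lemma simple_switch : simple_graph switch.
Proof.
apply/forallP=> e; apply/implyP; rewrite !inE.
case/or3P=> [/eqP-> | /eqP-> | /and3P[_ _ eG]]; rewrite ?cards2 ?neq_ac ?neq_bd //.
by have /forallP/(_ e)/implyP/(_ eG) := sG.
Qed.

(** Each of the four vertices loses one edge and gains one. *)
Lemma switch_same_degrees : same_degrees G switch.
Proof.
have sH := simple_switch; split=> // x; rewrite !degreeE //.
have neq_ab := adj_neq sG ab; have neq_cd := adj_neq sG cd.
have card2 (p q : T) : p != q -> (x \in [set p; q]) = (x == p) + (x == q) :> nat.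
  move=> pq; rewrite !inE; case: (eqVneq x p) => [->|_]; last by case: eqP.
  by rewrite (negPf pq).
(* If the two new edges coincided, then [a = d], and the edge [cd] would be the non-edge [ac]. *)
have acNbd : [set a; c] != [set b; d].
  rewrite eq_set2 (negPf neq_ab) /=; apply: contra nac => /andP[/eqP-> _].
  by rewrite adjC.
rewrite /switch big_setU1 /=; last first.
  by rewrite !inE (negPf acNbd) (negPf (nac : [set a; c] \notin G)) !andbF.
rewrite big_setU1 /=; last first.
  by rewrite !inE (negPf (nbd : [set b; d] \notin G)) !andbF.
rewrite [RHS](big_setD1 [set a; b]) //= [in RHS](big_setD1 [set c; d]) /=; last first.
  rewrite !inE (cd : [set c; d] \in G) andbT eq_set2 [c == a]eq_sym (negPf neq_ac) /=.
  by apply: contra nac => /andP[/eqP-> _].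
by rewrite !card2 // !addnA [_ + (x == c) + _]addnAC.
Qed.

End Switch.

(** * Vertex sets with a small edge boundary *)

Definition boundary G S : {set {set T}} :=
  [set e in G | ~~ (e \subset S) && ~~ (e \subset ~: S)].

(** This symmetry transfers every consequence of a small boundary from [S] to its complement. *)
Lemma boundaryC G S : boundary G (~: S) = boundary G S.
Proof. by apply/setP=> e; rewrite !inE setCK [X in _ && X]andbC. Qed.

Lemma adj_boundary G S (x y : T) : x \in S -> y \notin S ->
  ([set x; y] \in boundary G S) = adj G x y.
Proof. by move=> xS yS; rewrite inE !subUset !sub1set !inE xS (negPf yS) !andbT. Qed.

Section SmallCut.

Variables (G : {set {set T}}) (d : nat) (S : {set T}).
Hypotheses (sG : simple_graph G) (degG : forall x, d <= degree G x)
  (cut : #|boundary G S| < d).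

(* Otherwise x |-> xy (x in S), x |-> ux (x notin S) would inject the
   neighbourhood of u into the boundary of S. *)
Lemma exists_nonadj_neighbour (u y : T) : u \in S -> y \notin S ->
  exists x, [/\ x \in S, adj G u x & ~~ adj G x y].
Proof.
move=> uS yS.
case: (pickP [pred x | [&& x \in S, adj G u x & ~~ adj G x y]]) => [x /and3P[]|noE].
  by exists x.
have Sadj x : x \in S -> adj G u x -> adj G x y.
  by move=> xS ux; have:= noE x; rewrite /= xS ux => /negbFE.
pose f x := if x \in S then [set x; y] else [set u; x].
suff : degree G u <= #|boundary G S| by rewrite leqNgt (leq_trans cut (degG u)).
have inj : {in [set x | adj G u x] &, injective f}.
  move=> x z; rewrite !inE /f => ux uz.
  have [nux nuz] := (adj_neq sG ux, adj_neq sG uz).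
  case: ifPn => xS; case: ifPn => zS /eqP; rewrite eq_set2 ?eqxx ?andbT /=.
  - by case/orP=> [/eqP //|/andP[/eqP E _]]; rewrite -E xS in yS.
  - rewrite [x == u]eq_sym (negPf nux) /= => /andP[_ /eqP E].
    by rewrite E uS in yS.
  - by rewrite (negPf nuz) /= => /andP[/eqP E _]; rewrite -E uS in yS.
  - by case/orP=> [/eqP //|/andP[/eqP E _]]; rewrite -E uS in zS.
rewrite /degree -(card_in_imset inj) subset_leq_card //.
apply/subsetP=> _ /imsetP[x + ->]; rewrite inE /f => ux.
by case: ifPn => xS; rewrite adj_boundary // Sadj.
Qed.

End SmallCut.

(** * Changing the status of a given pair when a small cut exists *)

Section FlexibleEdges.

Variables (G : {set {set T}}) (d : nat) (S : {set T}).
Hypotheses (sG : simple_graph G) (degG : forall x, d <= degree G x)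
  (cut : #|boundary G S| < d) (S_neq0 : S != set0) (S_neqT : S != setT).

Let inside (u y : T) : u \in S -> y \notin S ->
  exists x, [/\ x \in S, adj G u x & ~~ adj G x y].
Proof. exact: exists_nonadj_neighbour sG degG cut u y. Qed.

Let outside (u y : T) : u \in S -> y \notin S ->
  exists x, [/\ x \notin S, adj G y x & ~~ adj G u x].
Proof.
move=> uS yS; have cutC : #|boundary G (~: S)| < d by rewrite boundaryC.
have [||x []] := exists_nonadj_neighbour sG degG cutC (u := y) (y := u).
- by rewrite inE.
- by rewrite inE uS.
by rewrite inE adjC => xS yx; rewrite adjC => ux; exists x; rewrite adjC.
Qed.

Let nonadj_outside (u : T) : u \in S -> exists2 y, y \notin S & ~~ adj G u y.
Proof.
move=> uS; have [t tS] : exists t, t \notin S.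
  by move: S_neqT; rewrite -subTset => /subsetPn[t _ tS]; exists t.
by have [x [xS _ ux]] := outside uS tS; exists x.
Qed.

Let nonadj_inside (u : T) : u \notin S -> exists2 y, y \in S & ~~ adj G y u.
Proof.
move=> uS; have [t tS] := set0Pn _ S_neq0.
by have [x [xS _ ux]] := inside tS uS; exists x.
Qed.

Let neqS (x y : T) : x \in S -> y \notin S -> x != y.
Proof. by move=> xS; apply: contraNneq => <-. Qed.

(** The trail u-v-y-x-u, with [y] and [x] outside [S], alternates, so one switch suffices. *)
Lemma remove_inner_edge (u v : T) : u \in S -> v \in S -> adj G u v ->
  exists2 H, same_degrees G H & ~~ adj H u v.
Proof.
move=> uS vS uv; have [y yS vy] := nonadj_outside vS.
have [x [xS yx ux]] := outside uS yS.
exists (switch G u v x y).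
  by apply: switch_same_degrees; rewrite // ?neqS // adjC.
exact: switch_removed.
Qed.

Lemma remove_crossing_edge (u v : T) : u \in S -> v \notin S -> adj G u v ->
  exists2 H, same_degrees G H & ~~ adj H u v.
Proof.
move=> uS vS uv; have [y yS yv] := nonadj_inside vS.
(* The trail u-v-y-x-t-z-u; x = u is allowed.  If zy is an edge, its part
   u-v-y-z-u suffices; otherwise a first switch makes zy an edge. *)
have [x [xS yx _]] := inside yS vS.
have [t tS xt] := nonadj_outside xS.
have [z [zS tz uz]] := outside uS tS.
have vy : ~~ adj G v y by rewrite adjC.
have [neq_vy neq_uz] : v != y /\ u != z by rewrite eq_sym !neqS.
have [zy|zy] := boolP (adj G z y).
  exists (switch G u v z y); first exact: switch_same_degrees.
  exact: switch_removed.
have neq_uy : u != y by apply: contraNneq yv => <-.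
have neq_vz : v != z by apply: contraNneq uz => <-.
have zt : adj G z t by rewrite adjC.
have tx : ~~ adj G t x by rewrite adjC.
have GK : same_degrees G (switch G z t y x).
  by apply: switch_same_degrees => //; rewrite eq_sym neqS.
have zyK := switch_added G z t y x.
set K := switch _ _ _ _ _ in GK zyK.
(* The first switch trades [zt], [yx] for [zy], [tx]. None of these is [uv], [uz] or [vy], so
   u-v-y-z-u alternates in [K]. *)
have uvK : adj K u v.
  apply: switch_kept_edge; first by [].
    by rewrite set2_neq // neqS.
  by rewrite setUC set2_neq // eq_sym neqS.
have uzK : ~~ adj K u z.
  apply: switch_kept_nonedge => //; first by rewrite set2_neq // neqS.
  by rewrite setUC set2_neq ?(adj_neq sG zt) // eq_sym neqS.
have vyK : ~~ adj K v y.
  apply: switch_kept_nonedge => //; first by rewrite set2_neq.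
  by rewrite setUC set2_neq ?(adj_neq sG yx) // neqS.
exists (switch K u v z y); last exact: switch_removed.
by apply: (same_degrees_trans GK); apply: switch_same_degrees => //; case: GK.
Qed.

Lemma add_inner_edge (u v : T) : u \in S -> v \in S -> u != v -> ~~ adj G u v ->
  exists2 H, same_degrees G H & adj H u v.
Proof.
move=> uS vS neq_uv uv; have [s sS _] := nonadj_outside uS.
have [y [yS uy _]] := inside uS sS.
(* The trail u-y-w-t-x-v-u; x = y is allowed.  If vw is an edge, its part
   u-y-w-v-u suffices; otherwise a first switch makes vw an edge. *)
have [x [xS vx _]] := inside vS sS.
have [t tS xt] := nonadj_outside xS.
have [w [wS tw yw]] := outside yS tS.
have [vw|vw] := boolP (adj G v w).
  exists (switch G u y v w); last exact: switch_added.
  by apply: switch_same_degrees; rewrite // neqS.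
have neq_uw : u != w by rewrite neqS.
have neq_yv : y != v by apply: contraNneq uv => <-.
have wt : adj G w t by rewrite adjC.
have GK : same_degrees G (switch G v x w t).
  by apply: switch_same_degrees => //; rewrite neqS.
have vwK := switch_added G v x w t.
set K := switch _ _ _ _ _ in GK vwK.
(* The first switch trades [vx], [wt] for [vw], [xt]. None of these is [uy], [uv] or [yw], so
   u-y-w-v-u alternates in [K]. *)
have uyK : adj K u y.
  apply: switch_kept_edge; first by [].
    rewrite eq_set2 (negPf neq_uv) /=; apply: contraNN neq_yv.
    by case/andP.
  by rewrite set2_neq // neqS.
have uvK : ~~ adj K u v.
  apply: switch_kept_nonedge => //; first by rewrite set2_neq.
  by rewrite eq_sym setUC set2_neq // eq_sym neqS.
have ywK : ~~ adj K y w.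
  apply: switch_kept_nonedge => //; first by rewrite set2_neq // neqS.
  by rewrite setUC set2_neq ?(adj_neq sG wt) // eq_sym neqS.
exists (switch K u y v w); last exact: switch_added.
apply: (same_degrees_trans GK); apply: switch_same_degrees => //; last by rewrite neqS.
by case: GK.
Qed.

(** One switch along u-x-y-v-u suffices, with [x] on the side of [u] and [y] on the side of [v]. *)
Lemma add_crossing_edge (u v : T) : u \in S -> v \notin S -> ~~ adj G u v ->
  exists2 H, same_degrees G H & adj H u v.
Proof.
move=> uS vS uv; have [y [yS vy _]] := outside uS vS.
have [x [xS ux xy]] := inside uS yS.
exists (switch G u x v y); last exact: switch_added.
by apply: switch_same_degrees; rewrite // neqS.
Qed.

End FlexibleEdges.

Lemma toggle_edge G (d : nat) S (u v : T) : simple_graph G ->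
    (forall x, d <= degree G x) -> #|boundary G S| < d ->
    S != set0 -> S != setT -> u != v ->
  exists2 H, same_degrees G H & adj H u v = ~~ adj G u v.
Proof.
move=> sG degG + + + uv; wlog uS : S / u \in S => [wl cut S0 ST|].
  have [/wl|uS] := boolP (u \in S); first exact.
  (* The hypotheses on [S] are invariant under complement, so [S] may be taken as the side
     containing [u]. *)
  apply: (wl (~: S)); rewrite ?boundaryC // ?inE //.
    by rewrite -setCT (inj_eq (@setC_inj _)).
  by rewrite -setC0 (inj_eq (@setC_inj _)).
move=> cut S0 ST; have [uvG|uvG] := boolP (adj G u v); have [vS|vS] := boolP (v \in S).
- by have [H GH /negPf] := remove_inner_edge sG degG cut ST uS vS uvG; exists H.
- by have [H GH /negPf] := remove_crossing_edge sG degG cut S0 ST uS vS uvG; exists H.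
- by have [H GH] := add_inner_edge sG degG cut ST uS vS uv uvG; exists H.
- by have [H GH] := add_crossing_edge sG degG cut uS vS uvG; exists H.
Qed.

(** * Edge cuts and boundaries *)

Lemma edge_cut_boundary G D : simple_graph G -> edge_cut G D ->
  exists S, [/\ S != set0, S != setT & boundary G S \subset D].
Proof.
move=> sG /andP[_ /forallPn[x /forallPn[y xy]]].
have symGD : connect_sym (adj (G :\: D)).
  by apply: sym_connect_sym => p q; rewrite adjC.
(* The component of [x] after removing [D]: an edge outside [D] cannot leave it. *)
exists [set z | connect (adj (G :\: D)) x z]; split.
- by apply/set0Pn; exists x; rewrite inE connect0.
- by apply: contraNneq xy => /setP/(_ y); rewrite !inE.
apply/subsetP=> e; rewrite inE => /andP[eG]; apply: contraTT => eD.
have [p [q [_ E]]] := simple_graph_edge sG eG.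
have pq : adj (G :\: D) p q by rewrite /adj /= -E inE eD.
have xpq : connect (adj (G :\: D)) x p = connect (adj (G :\: D)) x q.
  exact: same_connect_r symGD _ _ (connect1 pq) x.
by rewrite E !subUset !sub1set !inE xpq; case: connect.
Qed.

(** Removing all edges at [x] isolates it from [y]; this provides the upper bound on the edge
    connectivity. *)
Lemma edge_cut_star G (x y : T) : simple_graph G -> x != y ->
  exists2 D, edge_cut G D & #|D| = degree G x.
Proof.
move=> sG xy; exists [set e in G | x \in e]; last first.
  rewrite degreeE // -big_mkcondr sum1_card.
  by apply: eq_card => e; rewrite !inE.
apply/andP; split; first by apply/subsetP=> e; rewrite inE => /andP[].
apply/forallPn; exists x; apply/forallPn; exists y.
apply: contra xy => /connectP[[|z p] /=]; first by move=> _ ->.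
by case/andP; rewrite /adj /= !inE eqxx /= andbT => /andP[/negPf->].
Qed.

End Switching.

(** * Degree sequences and the conclusion *)

Lemma last_degree_sequence (n : nat) (alpha : n.-tuple nat) (i : 'I_n) :
  degree_sequence alpha -> last 0 alpha <= tnth alpha i.
Proof.
case/andP=> sorted_alpha _; rewrite -nth_last (tnth_nth 0) size_tuple.
have n_gt0 : 0 < n by case: n i {alpha sorted_alpha} => [[]|].
apply: (sorted_leq_nth _ _ 0 sorted_alpha); rewrite ?inE ?size_tuple //.
- by move=> a b c ba ac; apply: leq_trans ac ba.
- exact: leqnn.
- by rewrite ltn_predL.
- by rewrite -ltnS prednK.
Qed.

Lemma toggle_neither_forced_nor_forbidden (n : nat) (alpha : n.-tuple nat) :
    (forall u v : 'I_n, u != v -> exists G H,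
       [/\ realization alpha G, realization alpha H & adj H u v = ~~ adj G u v]) ->
  forbidden alpha = set0 /\ forced alpha = set0.
Proof.
move=> toggle; split; apply/setP=> e; rewrite !inE;
  apply/negP => /andP[/cards2P[u [v [uv ->]]] /forallP all_e];
  have [G [H [/(implyP (all_e G)) eG /(implyP (all_e H)) eH E]]] := toggle u v uv.
  by move: eG; rewrite -[_ \in G]/(adj G u v) -E /adj /= (negPf eH).
by move: eH; rewrite -[_ \in H]/(adj H u v) E /adj /= eG.
Qed.

Theorem theorem16 (n : nat) (alpha : n.-tuple nat)
  (alpha_seq : degree_sequence alpha) (alpha_graphic : graphic alpha)
  (alpha_n_ge1 : 1 <= last 0 alpha)
  (nonempty : forbidden alpha <> set0 \/ forced alpha <> set0) :
  forall G : {set {set 'I_n}}, realization alpha G ->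
    edge_connectivity G = last 0 alpha.
Proof.
move=> G realG; have /andP[sG /'forall_eqP degG] := realG.
(* Since the last term is positive, it is not the default 0 of an empty sequence, so some vertex has
   this degree. *)
have [i lastE] : exists i, last 0 alpha = tnth alpha i.
  apply/tnthP; suff: last 0 alpha \in tval alpha by [].
  by case: (tval alpha) alpha_n_ge1 => //= a s _; apply: mem_last.
(* A neighbour [j] of [i] gives a second vertex, so the edge connectivity is attained by a genuine
   edge cut. *)
have /card_gt0P[j] : 0 < degree G i by rewrite degG -lastE.
rewrite inE => /(adj_neq sG) ij.
have card_gt1 : 1 < #|'I_n| by apply/card_gt1P; exists i, j.
have [[D cutD <-] min_cut] := edge_connectivityP G card_gt1.
apply/eqP; rewrite eqn_leq; apply/andP; split.
  have [D' cutD' cardD'] := edge_cut_star sG ij.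
  by rewrite (leq_trans (min_cut _ cutD')) // cardD' degG lastE.
rewrite leqNgt; apply/negP => D_small.
(* A cut below the minimum degree contains a boundary that is equally small, which makes every pair
   flexible and contradicts [nonempty]. *)
have [S [S0 ST /subset_leq_card SD]] := edge_cut_boundary sG cutD.
have min_deg x : last 0 alpha <= degree G x by rewrite degG last_degree_sequence.
have [|forbidden0 forced0] := @toggle_neither_forced_nor_forbidden n alpha; last by case: nonempty.
move=> u v uv.
have [H [sH GH] E] := toggle_edge sG min_deg (leq_ltn_trans SD D_small) S0 ST uv.
exists G, H; split=> //; rewrite /realization sH.
by apply/'forall_eqP => x; rewrite GH.
Qed.
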